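(* Let $I=\{(1,3),(2,1),(3,2)\}$ and let $$A=\begin{pmatrix} u & z & 0 \\ 0 & v & x \\ y & 0 & w \end{pmatrix}\in L_I,\qquad w=-u-v,\quad x,y,z,u,v\in\mathbf{C}.$$ Then $\mathcal{O}_A$ and $L_I$ intersect non-transversally at $A$ if and only if $A$ lies on the real hypersurface $\Gamma_1\subset L_I$ defined by the equation $P_1=0$.
   Context: $L(3)$ is the space of traceless complex $3\times3$ matrices, $L_I\subset L(3)$ is the subspace of matrices whose entries at the positions $(1,3),(2,1),(3,2)$ are zero, and $\mathcal{O}_A=\{UAU^{-1}:U\in\mathrm{U}(3)\}$. $\mathcal{O}_A$ and $L_I$ intersect transversally at a point $B\in\mathcal{O}_A\cap L_I$ if the sum of $L_I$ and the tangent space of $\mathcal{O}_A$ at $B$ equals $L(3)$ (as real vector spaces), and non-transversally otherwise. $P_1:L_I\to\mathbf{R}$ is the homogeneous polynomial of degree 6 in the real and imaginary parts of $x,y,z,u,v$ given (with $w=-u-v$) by $$\begin{aligned}P_1(A)=\;&|(v-w)x^2|^2+|(w-u)y^2|^2+|(u-v)z^2|^2\\ &+\left(|(v-w)x|^2+|yz|^2\right)\left(|v|^2+|w|^2-5|u|^2\right)\\ &+\left(|(w-u)y|^2+|zx|^2\right)\left(|w|^2+|u|^2-5|v|^2\right)\\ &+\left(|(u-v)z|^2+|xy|^2\right)\left(|u|^2+|v|^2-5|w|^2\right)\\ &+|(u-v)(v-w)(w-u)|^2.\end{aligned}$$ *)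

(* Defs.v *)
From HB Require Import structures.
From mathcomp Require Import all_boot all_order all_algebra.
From mathcomp Require Import spectral.
From mathcomp.real_closed Require Import complex.
From mathcomp Require Import all_classical all_reals all_analysis.
Import Order.TTheory GRing.Theory Num.Theory.
Import numFieldNormedType.Exports.

Set Implicit Arguments.
Unset Strict Implicit.
Unset Printing Implicit Defensive.

Local Open Scope classical_set_scope.
Local Open Scope ring_scope.

Section Orbits.
Variable R : realType.
Local Notation C := R[i].

Definition orbit (n : nat) (A : 'M[C]_n) : set 'M[C]_n :=
  [set B | exists2 U : 'M[C]_n, U \is unitarymx & B = U *m A *m invmx U].

Definition traceless (n : nat) : set 'M[C]_n := [set A | \tr A = 0].

Definition pattern (n : nat) (I : {set 'I_n * 'I_n}) : set 'M[C]_n :=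
  [set A | traceless A /\ forall i j, (i, j) \in I -> A i j = 0].

Definition smooth (f : R -> R) : Prop :=
  forall (k : nat) (t : R), derivable (derive1n k f) t 1.

Definition smooth_curve (n : nat) (g : R -> 'M[C]_n) : Prop :=
  forall i j : 'I_n, smooth (fun t => complex.Re (g t i j)) /\
                     smooth (fun t => complex.Im (g t i j)).

Definition velocity (n : nat) (g : R -> 'M[C]_n) (t : R) : 'M[C]_n :=
  \matrix_(i, j)
    @Complex R (derive1 (fun s => complex.Re (g s i j)) t)
               (derive1 (fun s => complex.Im (g s i j)) t).

(* For an embedded submanifold M of the real vector space 'M[C]_n, such as a
   unitary orbit, this is the usual tangent space. Taking curves defined on the
   whole line instead of an open interval around 0 does not change it, by
   reparametrization. *)
Definition tangent_space (n : nat) (M : set 'M[C]_n) (B : 'M[C]_n) :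
    set 'M[C]_n :=
  [set T | exists g : R -> 'M[C]_n,
     [/\ smooth_curve g, forall t, M (g t), g 0 = B & velocity g 0 = T]].

Definition set_sum (n : nat) (S T : set 'M[C]_n) : set 'M[C]_n :=
  [set X + Y | X in S & Y in T].

Definition transversal_at (n : nat) (A : 'M[C]_n) (I : {set 'I_n * 'I_n})
    (B : 'M[C]_n) : Prop :=
  (orbit A `&` pattern I) B /\
  set_sum (pattern I) (tangent_space (orbit A) B) = @traceless n.

Definition nontransversal_at (n : nat) (A : 'M[C]_n) (I : {set 'I_n * 'I_n})
    (B : 'M[C]_n) : Prop :=
  (orbit A `&` pattern I) B /\
  set_sum (pattern I) (tangent_space (orbit A) B) <> @traceless n.

(* Indices start at 0: these are the positions (1,3), (2,1), (3,2). *)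
Definition I1 : {set 'I_3 * 'I_3} :=
  [set (inord 0, inord 2); (inord 1, inord 0); (inord 2, inord 1)]%SET.

Definition mxI1 (x y z u v : C) : 'M[C]_3 :=
  let w := - u - v in
  \matrix_(i < 3, j < 3)
    (nth [::] [:: [:: u; z; 0];
                  [:: 0; v; x];
                  [:: y; 0; w]] i)`_j.

Definition P1 (A : 'M[C]_3) : R :=
  let u := A (inord 0) (inord 0) in
  let v := A (inord 1) (inord 1) in
  let w := - u - v in
  let x := A (inord 1) (inord 2) in
  let y := A (inord 2) (inord 0) in
  let z := A (inord 0) (inord 1) in
  let m := @ComplexField.Normc.normc R in
  m ((v - w) * x ^+ 2) ^+ 2 + m ((w - u) * y ^+ 2) ^+ 2
    + m ((u - v) * z ^+ 2) ^+ 2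
  + (m ((v - w) * x) ^+ 2 + m (y * z) ^+ 2)
      * (m v ^+ 2 + m w ^+ 2 - 5 * m u ^+ 2)
  + (m ((w - u) * y) ^+ 2 + m (z * x) ^+ 2)
      * (m w ^+ 2 + m u ^+ 2 - 5 * m v ^+ 2)
  + (m ((u - v) * z) ^+ 2 + m (x * y) ^+ 2)
      * (m u ^+ 2 + m v ^+ 2 - 5 * m w ^+ 2)
  + m ((u - v) * (v - w) * (w - u)) ^+ 2.

Definition Gamma1 : set 'M[C]_3 := [set A | pattern I1 A /\ P1 A = 0].

End Orbits.

(* Main.v *)
(* The tangent space of the unitary orbit of [A] at [A] is the set of
   commutators [K A - A K] with [K] skew-Hermitian. Such a commutator is the
   velocity of [exp(tK) A exp(-tK)], whose entries are trigonometric
   polynomials once [K] is diagonalized. Conversely, let [g] be a curve in the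
   orbit with [g 0 = A]. The matrices [W] with [W A = g W] and
   [W A^* = g^* W] form the kernel of a self-adjoint operator depending
   polynomially on [g] and [g^*], whose spectrum does not depend on [t]; hence
   a fixed polynomial in this operator projects onto the kernel, and sends the
   identity to a differentiable curve [W t] of intertwiners with [W 0] a nonzero
   scalar. Differentiating both relations at [0] yields [g' = K A - A K].

   Transversality then means that the three entries of [K A - A K] at the
   positions of [I] depend on [K] surjectively. They form a real-linear map of
   the three entries [K_12, K_23, K_31], and the determinant of its
   complexification is [- P_1]. *)

From HB Require Import structures.
Require Import Defs.
From mathcomp Require Import all_boot all_order all_algebra.
From mathcomp Require Import spectral ring.
From mathcomp.real_closed Require Import complex.
From mathcomp Require Import all_classical all_reals all_analysis.
Import Order.TTheory GRing.Theory Num.Theory.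
Import numFieldNormedType.Exports.

Set Implicit Arguments.
Unset Strict Implicit.
Unset Printing Implicit Defensive.

Local Open Scope ring_scope.
Local Open Scope sesquilinear_scope.

(** * Adjoints and real-linear maps *)

Lemma trmxC_mul (C : numClosedFieldType) m n p
    (A : 'M[C]_(m, n)) (B : 'M[C]_(n, p)) :
  (A *m B) ^t* = B ^t* *m A ^t*.
Proof. by rewrite trmx_mul map_mxM. Qed.

Lemma mxtraceCE (C : numClosedFieldType) n (A : 'M[C]_n) :
  \tr (A ^t*) = Num.conj (\tr A).
Proof. by rewrite /mxtrace rmorph_sum; apply: eq_bigr => i _; rewrite !mxE. Qed.

Lemma mxtrace_mulCE (C : numClosedFieldType) m n (A : 'M[C]_(m, n)) :
  \tr (A *m A ^t*) = \sum_i \sum_j `|A i j| ^+ 2.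
Proof.
apply: eq_bigr => i _; rewrite mxE; apply: eq_bigr => j _.
by rewrite !mxE normCK.
Qed.

Lemma mxtrace_mulC_ge0 (C : numClosedFieldType) m n (A : 'M[C]_(m, n)) :
  0 <= \tr (A *m A ^t*).
Proof.
by rewrite mxtrace_mulCE; do 2![apply: sumr_ge0 => ? _]; rewrite exprn_ge0.
Qed.

Lemma mxtrace_mulC_eq0 (C : numClosedFieldType) m n (A : 'M[C]_(m, n)) :
  \tr (A *m A ^t*) = 0 -> A = 0.
Proof.
rewrite mxtrace_mulCE => /psumr_eq0P A0; apply/matrixP => i j; rewrite mxE.
have /psumr_eq0P Ai0 : \sum_j `|A i j| ^+ 2 = 0.
  by apply: A0 => // k _; apply: sumr_ge0 => ? _; rewrite exprn_ge0.
have /eqP := Ai0 (fun k _ => exprn_ge0 2 (normr_ge0 (A i k))) j isT.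
by rewrite expf_eq0 /= normr_eq0 => /eqP.
Qed.

Section RealLinear.
Variables (C : numClosedFieldType) (n : nat).
Implicit Types (M N : 'M[C]_n) (a t : 'cV[C]_n).

Lemma map_conjCK m p (A : 'M[C]_(m, p)) :
  map_mx Num.conj (map_mx Num.conj A) = A.
Proof. by apply/matrixP => i j; rewrite !mxE conjCK. Qed.

(* A real-linear map of C^n is surjective iff its complexification, written in
   the coordinates (a, conj a), is invertible. *)
Lemma real_linear_surjP M N :
  (forall t, exists a, M *m a + N *m map_mx Num.conj a = t) <->
  \det (block_mx M N (map_mx Num.conj N) (map_mx Num.conj M)) != 0.
Proof.
set B := block_mx _ _ _ _; split => [surj | detB t].
- apply/negP => /det0P [v v0 vB]; move/negP: v0; apply.
  rewrite -[v]hsubmxK in vB *; set r := lsubmx v in vB *.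
  set s := rsubmx v in vB *.
  move: vB; rewrite mul_row_block -(row_mx0 C 1 n n) => /eq_row_mx [e1 e2].
  (* With [t = M a + N conj a], the coefficients of [a] and [conj a] are the two blocks of [v *m B],
     which vanish. *)
  have rs t : r *m t + s *m map_mx Num.conj t = 0.
    have [a <-] := surj t.
    rewrite map_mxD !map_mxM map_conjCK !mulmxDr !mulmxA.
    rewrite [s *m _ *m _ + _]addrC addrACA -!mulmxDl.
    by rewrite e1 e2 !mul0mx addr0.
  have rs_i i c : c * r 0 i + Num.conj c * s 0 i = 0.
    have := congr1 (fun A : 'M[C]_1 => A 0 0) (rs (c *: delta_mx i 0)).
    rewrite map_mxZ map_delta_mx -!scalemxAr -!colE !mxE.
    by move=> ->.
  (* Testing [c = 1] and [c = 'i] separates the linear part from the antilinear one. *)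
  have r_i i : r 0 i = 0 /\ s 0 i = 0.
    have := rs_i i 'i; have := rs_i i 1; rewrite conjCi rmorph1 !mul1r mulNr.
    move/eqP; rewrite addr_eq0 => /eqP -> /eqP.
    rewrite mulrN -opprD oppr_eq0 -mulr2n mulrn_eq0 mulf_eq0.
    rewrite (negPf (neq0Ci C)) /=.
    by move/eqP => ->; rewrite oppr0.
  have -> : r = 0 by apply/rowP => j; rewrite [RHS]mxE; case: (r_i j).
  have -> : s = 0 by apply/rowP => j; rewrite [RHS]mxE; case: (r_i j).
  by rewrite row_mx0.
- pose s := invmx B *m col_mx t (map_mx Num.conj t).
  have : B *m s = col_mx t (map_mx Num.conj t).
    by rewrite mulKVmx // unitmxE unitfE.
  rewrite -[s]vsubmxK mul_block_col => /eq_col_mx [].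
  set p := usubmx s; set q := dsubmx s => e1.
  move/(congr1 (map_mx Num.conj)).
  rewrite map_mxD !map_mxM !map_conjCK => e2.
  (* A solution [(p, q)] need not satisfy [q = conj p], but [(conj q, conj p)] is a solution too,
     and the average of the two has this form. *)
  exists (2^-1 *: (p + map_mx Num.conj q)).
  rewrite map_mxZ map_mxD map_conjCK fmorphV rmorph_nat -!scalemxAr -scalerDr.
  rewrite !mulmxDr [N *m _ + _]addrC addrACA e1 [M *m _ + _]addrC e2.
  by rewrite -mulr2n -scalerMnr scalerMnl -mulr_natr mulVf ?scale1r // pnatr_eq0.
Qed.
End RealLinear.

(** * Intertwiners *)

Section Intertwiners.
Variables (C : numClosedFieldType) (n : nat).
Implicit Types (A G U W X Y : 'M[C]_n).

Definition intertwining A G W := W *m A - G *m W.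

Lemma intertwining_is_linear A G : linear (intertwining A G).
Proof.
move=> c X Y; rewrite /intertwining mulmxDl mulmxDr -scalemxAl -scalemxAr.
by rewrite scalerBr opprD addrACA.
Qed.

HB.instance Definition _ A G :=
  GRing.isLinear.Build C 'M[C]_n 'M[C]_n _ (intertwining A G)
    (intertwining_is_linear A G).

(* [S^* S] for [S W = (W A - G W, W A^* - G^* W)]. *)
Definition intertwiner_laplacian A G W :=
  intertwining (A ^t*) (G ^t*) (intertwining A G W) +
  intertwining A G (intertwining (A ^t*) (G ^t*) W).

Lemma intertwiner_laplacian_is_linear A G :
  linear (intertwiner_laplacian A G).
Proof.
by move=> c X Y; rewrite /intertwiner_laplacian !linearP scalerDr addrACA.
Qed.

HB.instance Definition _ A G :=
  GRing.isLinear.Build C 'M[C]_n 'M[C]_n _ (intertwiner_laplacian A G)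
    (intertwiner_laplacian_is_linear A G).

Lemma intertwining_adj A W :
  (intertwining A A W) ^t* = - intertwining (A ^t*) (A ^t*) (W ^t*).
Proof.
by rewrite /intertwining linearB /= map_mxB !trmxC_mul opprB.
Qed.

Lemma mxtraceB X Y : \tr (X - Y) = \tr X - \tr Y.
Proof. by rewrite linearB. Qed.

(** Cyclicity of the trace. Together with [intertwining_adj] it makes the operators for [A] and
    [A ^t*] adjoint to each other. *)
Lemma mxtrace_intertwining A X Y :
  \tr (intertwining A A X *m Y) = - \tr (X *m intertwining A A Y).
Proof.
rewrite /intertwining mulmxBl mulmxBr !mxtraceB opprB !mulmxA.
by rewrite [\tr (A *m _ *m _)]mxtrace_mulC mulmxA
  [\tr (Y *m _ *m _)]mxtrace_mulC mulmxA.
Qed.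

Lemma mxtrace_intertwiner_laplacian A X Y :
  \tr (intertwiner_laplacian A A X *m Y ^t*) =
  \tr (intertwining A A X *m (intertwining A A Y) ^t*) +
  \tr (intertwining (A ^t*) (A ^t*) X *m (intertwining (A ^t*) (A ^t*) Y) ^t*).
Proof.
rewrite mulmxDl mxtraceD !intertwining_adj trmxCK !mulmxN.
rewrite ![\tr (- _)]raddfN /=.
by congr (_ + _); apply: mxtrace_intertwining.
Qed.

Lemma intertwiner_laplacian_self_adj A X Y :
  \tr (intertwiner_laplacian A A X *m Y ^t*) =
  \tr (X *m (intertwiner_laplacian A A Y) ^t*).
Proof.
transitivity (Num.conj (\tr (intertwiner_laplacian A A Y *m X ^t*))).
  rewrite !mxtrace_intertwiner_laplacian rmorphD /= -!mxtraceCE !trmxC_mul.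
  by rewrite !trmxCK.
by rewrite -mxtraceCE trmxC_mul trmxCK.
Qed.

Lemma intertwiner_laplacian_ker A X :
  intertwiner_laplacian A A X = 0 ->
  intertwining A A X = 0 /\ intertwining (A ^t*) (A ^t*) X = 0.
Proof.
move=> LX; have := mxtrace_intertwiner_laplacian A X X.
rewrite LX mul0mx linear0 => /esym/eqP.
rewrite paddr_eq0 ?mxtrace_mulC_ge0 // => /andP[/eqP h1 /eqP h2].
by split; apply: mxtrace_mulC_eq0.
Qed.

(** A self-adjoint operator [L] has no nilpotent part: the squared norm of [L^(k+1) X] is the inner
    product of [L^(k+2) X] with [L^k X]. *)
Lemma intertwiner_laplacian_iter_ker A k X :
  iter k (intertwiner_laplacian A A) X = 0 -> intertwiner_laplacian A A X = 0.
Proof.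
elim: k => [/= ->|[//|k] IHk /= L2]; first exact: linear0.
apply: IHk => /=; apply: mxtrace_mulC_eq0.
by rewrite -intertwiner_laplacian_self_adj L2 mul0mx linear0.
Qed.

Lemma trmxC_unitary_conj A U : U \is unitarymx ->
  (U *m A *m invmx U) ^t* = U *m A ^t* *m invmx U.
Proof.
by move=> Uu; rewrite invmx_unitary // !trmxC_mul trmxCK mulmxA.
Qed.

Lemma intertwining_conj A U W : U \in unitmx ->
  intertwining A (U *m A *m invmx U) (U *m W) = U *m intertwining A A W.
Proof.
by move=> Uu; rewrite /intertwining mulmxBr !mulmxA mulmxKV.
Qed.

(** Unitarity makes [U] conjugate [A ^t*] as well as [A]. Left multiplication by [U] thus carries
    the Laplacian of [(A, A)] to that of any pair along the orbit, and one polynomial serves them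
    all. *)
Lemma intertwiner_laplacian_conj A U W : U \is unitarymx ->
  intertwiner_laplacian A (U *m A *m invmx U) (U *m W) =
  U *m intertwiner_laplacian A A W.
Proof.
move=> Uu; rewrite /intertwiner_laplacian trmxC_unitary_conj //.
by rewrite !intertwining_conj ?unitarymx_unit // mulmxDr.
Qed.

Lemma iter_intertwiner_laplacian_conj A U W k : U \is unitarymx ->
  iter k (intertwiner_laplacian A (U *m A *m invmx U)) (U *m W) =
  U *m iter k (intertwiner_laplacian A A) W.
Proof.
by move=> Uu; elim: k => //= k ->; rewrite intertwiner_laplacian_conj.
Qed.

Lemma intertwiner_laplacian1 A : intertwiner_laplacian A A 1%:M = 0.
Proof.
rewrite /intertwiner_laplacian /intertwining !(mul1mx, mulmx1) !subrr.
by rewrite !(mul0mx, mulmx0) subrr addr0.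
Qed.

End Intertwiners.

(** * Polynomials in an endomorphism of a matrix space *)

Section PolynomialInEndomorphism.
Variables (F : fieldType) (n : nat).
Implicit Types (f : {linear 'M[F]_n.+1 -> 'M[F]_n.+1}) (p q : {poly F}).

(** Written with iterates, so that it can be differentiated term by term when [f] varies along a
    curve. *)
Definition poly_iter (f : 'M[F]_n.+1 -> 'M[F]_n.+1) p X :=
  \sum_(i < size p) p`_i *: iter i f X.

Lemma mxvec_iter f X k :
  mxvec (iter k f X) = mxvec X *m (lin_mx f) ^+ k.
Proof.
elim: k => [|k IHk]; first by rewrite expr0 mulmx1.
by rewrite iterS -mul_vec_lin IHk exprSr -mulmxA.
Qed.

Lemma mxvec_poly_iter f p X :
  mxvec (poly_iter f p X) = mxvec X *m horner_mx (lin_mx f) p.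
Proof.
rewrite -[in RHS](coefK p) poly_def !linear_sum /=.
apply: eq_bigr => i _.
by rewrite !linearZ /= mxvec_iter rmorphXn /= horner_mx_X.
Qed.

(* Cayley-Hamilton, with the factor ['X^k] split off. *)
Lemma poly_iter_annihilator f :
  exists k q, ~~ root q 0 /\ forall X, iter k f (poly_iter f q X) = 0.
Proof.
have [k [q q0 chE]] := multiplicity_XsubC (char_poly (lin_mx f)) 0.
exists k, q; split=> [|X].
  by move: q0; rewrite monic_neq0 ?char_poly_monic.
apply/eqP; rewrite -mxvec_eq0 mxvec_iter mxvec_poly_iter -mulmxA.
have := Cayley_Hamilton (lin_mx f); rewrite chE polyC0 subr0 rmorphM rmorphXn /=.
rewrite horner_mx_X => CH.
by rewrite [X in _ *m X](_ : _ = 0) ?mulmx0.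
Qed.

(** On the kernel only the constant term survives; this gives the scalar value of the curve of
    intertwiners at time 0. *)
Lemma poly_iter_ker f q X : f X = 0 -> poly_iter f q X = q`_0 *: X.
Proof.
move=> fX; rewrite /poly_iter; case sq: (size q) => [|m].
  by rewrite big_ord0 nth_default ?sq // scale0r.
rewrite big_ord_recl big1 ?addr0 // => i _; rewrite lift0 iterSr fX.
suff -> : iter i f 0 = 0 by rewrite scaler0.
by elim: (i : nat) => //= j ->; rewrite linear0.
Qed.

End PolynomialInEndomorphism.

Lemma poly_iter_intertwiner_laplacian_conj (C : numClosedFieldType) n
    (A U W : 'M[C]_n.+1) (q : {poly C}) : U \is unitarymx ->
  poly_iter (intertwiner_laplacian A (U *m A *m invmx U)) q (U *m W) =
  U *m poly_iter (intertwiner_laplacian A A) q W.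
Proof.
move=> Uu; rewrite /poly_iter mulmx_sumr; apply: eq_bigr => i _.
rewrite -scalemxAr; congr (_ *: _).
exact: iter_intertwiner_laplacian_conj.
Qed.

(** With [H = E / c], the first relation makes [T] the commutator of [H] with [A], and the adjoint
    of the second that of [- H ^t*]. The average of these two matrices is skew-Hermitian. *)
Lemma skew_commutator (C : numClosedFieldType) n c (A E T : 'M[C]_n) : c != 0 ->
  E *m A = c *: T + A *m E -> E *m A ^t* = c *: T ^t* + A ^t* *m E ->
  exists2 K, K ^t* = - K & T = K *m A - A *m K.
Proof.
move=> c0 e1 e2; pose H := c^-1 *: E.
have h1 : T = H *m A - A *m H.
  by rewrite -scalemxAl -scalemxAr e1 -scalerBr addrK scalerA mulVf ?scale1r.
have h2 : T ^t* = H *m A ^t* - A ^t* *m H.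
  by rewrite -scalemxAl -scalemxAr e2 -scalerBr addrK scalerA mulVf ?scale1r.
have h3 : T = A *m H ^t* - H ^t* *m A.
  by rewrite -[T]trmxCK h2 raddfB /= map_mxB !trmxC_mul !trmxCK.
exists (2^-1 *: (H - H ^t*)).
  rewrite linearZ /= map_mxZ fmorphV rmorph_nat -scalerN; congr (_ *: _).
  by rewrite raddfB /= map_mxB trmxCK opprB.
rewrite -scalemxAl -scalemxAr -scalerBr mulmxBl mulmxBr opprB.
have -> : H *m A - H ^t* *m A + (A *m H ^t* - A *m H) = T + T.
  by rewrite {1}h1 h3 addrACA [- (H ^t* *m A) + _]addrC addrACA.
by rewrite -mulr2n -scalerMnr scalerMnl -mulr_natr mulVf ?scale1r // pnatr_eq0.
Qed.

(** * Differentiation of complex matrix curves *)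

Section ComplexDerivative.
Variable R : realType.
Local Notation C := R[i].
Implicit Types (f g : R -> C) (c d : C).

(** Taken on real and imaginary parts, as in [velocity] and [smooth_curve]. *)
Definition is_cderive (t : R) f d :=
  is_derive t 1 (fun s => complex.Re (f s)) (complex.Re d) /\
  is_derive t 1 (fun s => complex.Im (f s)) (complex.Im d).

Lemma is_derive_ext (t : R) (f g : R -> R) (a b : R) :
  f =1 g -> a = b -> is_derive t 1 f a -> is_derive t 1 g b.
Proof. by move=> /funext -> ->. Qed.

Lemma is_cderive_cst t c : is_cderive t (fun=> c) 0.
Proof. by split; exact: is_derive_cst. Qed.

Lemma is_cderiveD t f g df dg : is_cderive t f df -> is_cderive t g dg ->
  is_cderive t (fun s => f s + g s) (df + dg).
Proof.
move=> [f1 f2] [g1 g2]; split.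
  by apply: is_derive_ext (is_deriveD f1 g1) => [s|] /=; rewrite raddfD.
by apply: is_derive_ext (is_deriveD f2 g2) => [s|] /=; rewrite raddfD.
Qed.

Lemma is_cderiveN t f df : is_cderive t f df ->
  is_cderive t (fun s => - f s) (- df).
Proof.
move=> [f1 f2]; split.
  by apply: is_derive_ext (is_deriveN f1) => [s|] /=; rewrite raddfN.
by apply: is_derive_ext (is_deriveN f2) => [s|] /=; rewrite raddfN.
Qed.

Lemma Re_conj (z : C) : complex.Re (Num.conj z) = complex.Re z.
Proof. by case: z. Qed.

Lemma Im_conj (z : C) : complex.Im (Num.conj z) = - complex.Im z.
Proof. by case: z. Qed.

Lemma is_cderive_conj t f df : is_cderive t f df ->
  is_cderive t (fun s => Num.conj (f s)) (Num.conj df).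
Proof.
move=> [f1 f2]; split.
  by apply: is_derive_ext f1 => [s|]; rewrite Re_conj.
by apply: is_derive_ext (is_deriveN f2) => [s|] /=; rewrite Im_conj.
Qed.

Lemma ReD (a b : C) : complex.Re (a + b) = complex.Re a + complex.Re b.
Proof. by rewrite raddfD. Qed.

Lemma ImD (a b : C) : complex.Im (a + b) = complex.Im a + complex.Im b.
Proof. by rewrite raddfD. Qed.

Lemma ReM (a b : C) : complex.Re (a * b) =
  complex.Re a * complex.Re b - complex.Im a * complex.Im b.
Proof. by case: a b => ? ? []. Qed.

Lemma ImM (a b : C) : complex.Im (a * b) =
  complex.Re a * complex.Im b + complex.Im a * complex.Re b.
Proof. by case: a b => ? ? []. Qed.

Lemma is_cderiveM t f g df dg : is_cderive t f df -> is_cderive t g dg ->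
  is_cderive t (fun s => f s * g s) (df * g t + f t * dg).
Proof.
move=> [f1 f2] [g1 g2]; split.
  apply: is_derive_ext (is_deriveB (is_deriveM f1 g1) (is_deriveM f2 g2)).
    by move=> s; rewrite ReM.
  by rewrite ReD !ReM /GRing.scale /=; ring.
apply: is_derive_ext (is_deriveD (is_deriveM f1 g2) (is_deriveM f2 g1)).
  by move=> s; rewrite ImM.
by rewrite ImD !ImM /GRing.scale /=; ring.
Qed.

Lemma is_cderive_sum t (I : finType) (F : I -> R -> C) (dF : I -> C) :
  (forall i, is_cderive t (F i) (dF i)) ->
  is_cderive t (fun s => \sum_i F i s) (\sum_i dF i).
Proof.
move=> FdF; elim: (index_enum I) => [|i r IHr].
  rewrite big_nil; have := is_cderive_cst t 0.
  by congr is_cderive; apply/funext => s; rewrite big_nil.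
rewrite big_cons; have := is_cderiveD (FdF i) IHr.
by congr is_cderive; apply/funext => s; rewrite big_cons.
Qed.

Lemma is_cderive_unique t f d1 d2 :
  is_cderive t f d1 -> is_cderive t f d2 -> d1 = d2.
Proof.
move=> [f1 f2] [g1 g2].
have e1 : complex.Re d1 = complex.Re d2.
  by rewrite -(@derive_val _ _ _ _ _ _ _ f1) (@derive_val _ _ _ _ _ _ _ g1).
have e2 : complex.Im d1 = complex.Im d2.
  by rewrite -(@derive_val _ _ _ _ _ _ _ f2) (@derive_val _ _ _ _ _ _ _ g2).
by case: d1 d2 e1 e2 {f1 f2 g1 g2} => ? ? [? ?] /= -> ->.
Qed.

Definition is_mxderive m n (t : R) (F : R -> 'M[C]_(m, n)) (D : 'M[C]_(m, n)) :=
  forall i j, is_cderive t (fun s => F s i j) (D i j).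

Lemma is_mxderive_cst m n t (A : 'M[C]_(m, n)) : is_mxderive t (fun=> A) 0.
Proof. by move=> i j; rewrite mxE; exact: is_cderive_cst. Qed.

Lemma is_mxderiveD m n t (F G : R -> 'M[C]_(m, n)) DF DG :
  is_mxderive t F DF -> is_mxderive t G DG ->
  is_mxderive t (fun s => F s + G s) (DF + DG).
Proof.
move=> FD GD i j; rewrite mxE; have := is_cderiveD (FD i j) (GD i j).
by congr is_cderive; apply/funext => s; rewrite mxE.
Qed.

Lemma is_mxderiveN m n t (F : R -> 'M[C]_(m, n)) DF :
  is_mxderive t F DF -> is_mxderive t (fun s => - F s) (- DF).
Proof.
move=> FD i j; rewrite mxE; have := is_cderiveN (FD i j).
by congr is_cderive; apply/funext => s; rewrite mxE.
Qed.

Lemma is_mxderiveC m n t (F : R -> 'M[C]_(m, n)) DF :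
  is_mxderive t F DF -> is_mxderive t (fun s => (F s) ^t*) (DF ^t*).
Proof.
move=> FD i j; rewrite !mxE; have := is_cderive_conj (FD j i).
by congr is_cderive; apply/funext => s; rewrite !mxE.
Qed.

Lemma is_mxderiveM m n p t (F : R -> 'M[C]_(m, n))
    (G : R -> 'M[C]_(n, p)) DF DG :
  is_mxderive t F DF -> is_mxderive t G DG ->
  is_mxderive t (fun s => F s *m G s) (DF *m G t + F t *m DG).
Proof.
move=> FD GD i j; rewrite !mxE -big_split /=.
have := is_cderive_sum (fun k => is_cderiveM (FD i k) (GD k j)).
by congr is_cderive; apply/funext => s; rewrite mxE.
Qed.

Lemma is_mxderive_unique m n t (F : R -> 'M[C]_(m, n)) D1 D2 :
  is_mxderive t F D1 -> is_mxderive t F D2 -> D1 = D2.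
Proof.
move=> F1 F2; apply/matrixP => i j.
exact: is_cderive_unique (F1 i j) (F2 i j).
Qed.

Lemma is_mxderive_velocity n (g : R -> 'M[C]_n) t :
  smooth_curve g -> is_mxderive t g (velocity g t).
Proof.
move=> gs i j; rewrite mxE; have [g1 g2] := gs i j.
by split; rewrite /= derive1E; apply: derivableP;
  [apply: (g1 0%N) | apply: (g2 0%N)].
Qed.

Lemma velocityE n (g : R -> 'M[C]_n) t D :
  is_mxderive t g D -> velocity g t = D.
Proof.
move=> gD; apply/matrixP => i j; rewrite mxE !derive1E.
have [g1 g2] := gD i j.
rewrite (@derive_val _ _ _ _ _ _ _ g1) (@derive_val _ _ _ _ _ _ _ g2).
by case: (D i j).
Qed.
End ComplexDerivative.

(** * The tangent space of a unitary orbit *)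

Section TangentSpaceSub.
Variables (R : realType) (n : nat).
Local Notation C := R[i].
Implicit Types (A : 'M[C]_n.+1).

Lemma is_mxderive_intertwining A (h F : R -> 'M[C]_n.+1) t Dh DF :
  is_mxderive t h Dh -> is_mxderive t F DF ->
  is_mxderive t (fun s => intertwining A (h s) (F s))
    (DF *m A + F t *m 0 + - (Dh *m F t + h t *m DF)).
Proof.
move=> hD FD; apply: is_mxderiveD.
  exact: is_mxderiveM FD (is_mxderive_cst t A).
exact/is_mxderiveN/is_mxderiveM.
Qed.

Lemma is_mxderive_iter_intertwiner_laplacian A (g : R -> 'M[C]_n.+1) t D k :
  is_mxderive t g D -> exists E,
    is_mxderive t (fun s => iter k (intertwiner_laplacian A (g s)) 1%:M) E.
Proof.
move=> gD; have gCD := is_mxderiveC gD.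
elim: k => [|k [E IHk]]; first by exists 0; exact: is_mxderive_cst.
eexists; apply: is_mxderiveD.
  exact: is_mxderive_intertwining gCD (is_mxderive_intertwining A gD IHk).
exact: is_mxderive_intertwining gD (is_mxderive_intertwining (A ^t*) gCD IHk).
Qed.

Lemma is_mxderive_poly_iter A (g : R -> 'M[C]_n.+1) t D q :
  is_mxderive t g D -> exists E,
    is_mxderive t (fun s => poly_iter (intertwiner_laplacian A (g s)) q 1%:M) E.
Proof.
move=> gD; rewrite /poly_iter; elim: (size q) => [|m [E IHm]].
  exists 0; have := is_mxderive_cst t (0 : 'M[C]_n.+1).
  by congr is_mxderive; apply/funext => s; rewrite big_ord0.
have [F FD] := is_mxderive_iter_intertwiner_laplacian A m gD.
(* Scaling by the coefficient is treated as a product with a constant scalar matrix, whence the term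
   with derivative 0. *)
exists (E + (0 *m iter m (intertwiner_laplacian A (g t)) 1%:M + (q`_m)%:M *m F)).
have := is_mxderiveD IHm (is_mxderiveM (is_mxderive_cst t (q`_m)%:M) FD).
congr is_mxderive; apply/funext => s.
by rewrite big_ord_recr /= mul_scalar_mx.
Qed.

(* For a suitable polynomial [q], applying [q] of the Laplacian of the pair
   [(A, g t)] to the identity projects it onto the intertwiners of [A] and
   [g t]; unlike a choice of unitaries with [g t = U A U^-1], this is
   differentiable in [t]. *)
Lemma tangent_space_orbit_sub A T :
  tangent_space (Defs.orbit A) A T ->
  exists2 K, K ^t* = - K & T = K *m A - A *m K.
Proof.
case=> g [gs gA g0 <-]; have gD := is_mxderive_velocity 0 gs.
set T0 := velocity g 0 in gD *.
have [k [q [q0 qL]]] := poly_iter_annihilator (intertwiner_laplacian A A).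
have [E WE] := is_mxderive_poly_iter A q gD.
pose W s := poly_iter (intertwiner_laplacian A (g s)) q 1%:M.
have intW s : W s *m A = g s *m W s /\ W s *m A ^t* = (g s) ^t* *m W s.
  have [U Uu gsE] := gA s.
  (* The identity is [U *m invmx U], which moves the computation to the Laplacian of [(A, A)], for
     which [q] was chosen. *)
  have WsE : W s = U *m poly_iter (intertwiner_laplacian A A) q (invmx U).
    rewrite /W gsE.
    have := poly_iter_intertwiner_laplacian_conj A (invmx U) q Uu.
    by rewrite {1}(mulmxV (unitarymx_unit Uu)).
  set V := poly_iter _ _ (invmx U) in WsE.
  have /intertwiner_laplacian_ker [V1 V2] : intertwiner_laplacian A A V = 0.
    exact: intertwiner_laplacian_iter_ker (qL _).
  have UU := unitarymx_unit Uu.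
  split; apply/eqP; rewrite -subr_eq0; apply/eqP; rewrite WsE gsE.
    by have := intertwining_conj A V UU; rewrite V1 mulmx0.
  rewrite (trmxC_unitary_conj A Uu).
  by have := intertwining_conj (A ^t*) V UU; rewrite V2 mulmx0.
have W0 : W 0 = (q`_0)%:M.
  rewrite /W g0 (poly_iter_ker (f := intertwiner_laplacian A A)).
    by rewrite scalemx1.
  exact: intertwiner_laplacian1.
have q00 : q`_0 != 0 by move: q0; rewrite /root horner_coef0.
(* Both sides are derivatives at 0 of the same curve, computed from the two sides of the
   intertwining relation; likewise for [e2]. *)
have e1 : E *m A + W 0 *m 0 = T0 *m W 0 + g 0 *m E.
  apply: is_mxderive_unique (is_mxderiveM WE (is_mxderive_cst 0 A)) _.
  have := is_mxderiveM gD WE.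
  by congr is_mxderive; apply/funext => s; case: (intW s).
have e2 : E *m A ^t* + W 0 *m 0 = T0 ^t* *m W 0 + (g 0) ^t* *m E.
  apply: is_mxderive_unique (is_mxderiveM WE (is_mxderive_cst 0 (A ^t*))) _.
  have := is_mxderiveM (is_mxderiveC gD) WE.
  by congr is_mxderive; apply/funext => s; case: (intW s).
move: e1 e2; rewrite W0 g0 !mulmx0 !addr0 !mul_mx_scalar.
exact: skew_commutator.
Qed.

End TangentSpaceSub.

(** * Trigonometric one-parameter curves in the orbit *)

Section TrigonometricCurves.
Variable R : realType.
Local Notation C := R[i].

(** A class closed under differentiation, so that smoothness follows by induction on the order. *)
Inductive trigpoly : (R -> R) -> Prop :=
| trigpoly_cst a : trigpoly (fun=> a)
| trigpoly_cos a : trigpoly (fun t => cos (a * t))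
| trigpoly_sin a : trigpoly (fun t => sin (a * t))
| trigpolyD f g : trigpoly f -> trigpoly g -> trigpoly (fun t => f t + g t)
| trigpolyM f g : trigpoly f -> trigpoly g -> trigpoly (fun t => f t * g t).

Lemma is_derive_mulrl (a t : R) : is_derive t 1 (fun s => a * s) a.
Proof.
apply: is_derive_ext (is_deriveZ a (is_derive_id t 1)) => //.
by rewrite /GRing.scale /= mulr1.
Qed.

Lemma is_derive_cosM (a t : R) :
  is_derive t 1 (fun s => cos (a * s)) (- a * sin (a * t)).
Proof.
have cosD := is_derive1_comp (is_derive_cos (a * t)) (is_derive_mulrl a t).
apply: is_derive_ext cosD => //.
by rewrite mulrC mulrN mulNr.
Qed.

Lemma is_derive_sinM (a t : R) :
  is_derive t 1 (fun s => sin (a * s)) (a * cos (a * t)).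
Proof.
have sinD := is_derive1_comp (is_derive_sin (a * t)) (is_derive_mulrl a t).
apply: is_derive_ext sinD => //.
by rewrite mulrC.
Qed.

Lemma trigpoly_derive f : trigpoly f ->
  exists2 f', trigpoly f' & forall t : R, is_derive t 1 f (f' t).
Proof.
elim=> [a|a|a|{}f g _ [f' f'T fD] _ [g' g'T gD]
  |{}f g fT [f' f'T fD] gT [g' g'T gD]].
- by exists (fun=> 0); [exact: trigpoly_cst | move=> t; exact: is_derive_cst].
- exists (fun t => - a * sin (a * t)) => [|t]; last exact: is_derive_cosM.
  exact/trigpolyM/trigpoly_sin/trigpoly_cst.
- exists (fun t => a * cos (a * t)) => [|t]; last exact: is_derive_sinM.
  exact/trigpolyM/trigpoly_cos/trigpoly_cst.
- exists (fun t => f' t + g' t) => [|t]; first exact: trigpolyD.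
  exact: is_deriveD (fD t) (gD t).
- exists (fun t => f t * g' t + g t * f' t) => [|t].
    by apply: trigpolyD; apply: trigpolyM.
  exact: is_deriveM (fD t) (gD t).
Qed.

Lemma trigpoly_smooth f : trigpoly f -> smooth f.
Proof.
move=> fT k; elim: k f fT => [|k IHk] f /trigpoly_derive [f' f'T fD] t.
  by case: (fD t).
rewrite derive1Sn; suff -> : derive1 f = f' by exact: IHk.
by apply/funext => s; rewrite derive1E (@derive_val _ _ _ _ _ _ _ (fD s)).
Qed.

Definition trigmx m n (F : R -> 'M[C]_(m, n)) :=
  forall i j, trigpoly (fun t => complex.Re (F t i j)) /\
              trigpoly (fun t => complex.Im (F t i j)).

Lemma trigpolyB f g : trigpoly f -> trigpoly g -> trigpoly (fun t => f t - g t).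
Proof.
move=> fT gT; have := trigpolyD fT (trigpolyM (trigpoly_cst (-1)) gT).
by congr trigpoly; apply/funext => t; rewrite mulN1r.
Qed.

Lemma trigpoly_sum (I : finType) (F : I -> R -> R) :
  (forall i, trigpoly (F i)) -> trigpoly (fun t => \sum_i F i t).
Proof.
move=> FT; elim: (index_enum I) => [|i r IHr].
  have := trigpoly_cst 0.
  by congr trigpoly; apply/funext => s; rewrite big_nil.
have := trigpolyD (FT i) IHr.
by congr trigpoly; apply/funext => s; rewrite big_cons.
Qed.

Lemma trigmx_cst m n (A : 'M[C]_(m, n)) : trigmx (fun=> A).
Proof. by move=> i j; split; exact: trigpoly_cst. Qed.

Lemma trigmxC m n (F : R -> 'M[C]_(m, n)) :
  trigmx F -> trigmx (fun t => (F t) ^t*).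
Proof.
move=> FT i j; have [F1 F2] := FT j i; split.
  by move: F1; congr trigpoly; apply/funext => t; rewrite !mxE Re_conj.
have := trigpolyB (trigpoly_cst 0) F2.
by congr trigpoly; apply/funext => t; rewrite !mxE Im_conj sub0r.
Qed.

Lemma trigmxM m n p (F : R -> 'M[C]_(m, n)) (G : R -> 'M[C]_(n, p)) :
  trigmx F -> trigmx G -> trigmx (fun t => F t *m G t).
Proof.
move=> FT GT i j; split.
  have : trigpoly (fun t =>
      \sum_k (complex.Re (F t i k) * complex.Re (G t k j) -
              complex.Im (F t i k) * complex.Im (G t k j))).
    apply: trigpoly_sum => k; have [F1 F2] := FT i k; have [G1 G2] := GT k j.
    by apply: trigpolyB; apply: trigpolyM.
  congr trigpoly; apply/funext => t; rewrite mxE raddf_sum.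
  by apply: eq_bigr => k _; exact/esym/ReM.
have : trigpoly (fun t =>
    \sum_k (complex.Re (F t i k) * complex.Im (G t k j) +
            complex.Im (F t i k) * complex.Re (G t k j))).
  apply: trigpoly_sum => k; have [F1 F2] := FT i k; have [G1 G2] := GT k j.
  by apply: trigpolyD; apply: trigpolyM.
congr trigpoly; apply/funext => t; rewrite mxE raddf_sum.
by apply: eq_bigr => k _; exact/esym/ImM.
Qed.

Lemma trigmx_smooth_curve n (F : R -> 'M[C]_n) : trigmx F -> smooth_curve F.
Proof.
by move=> FT i j; have [F1 F2] := FT i j; split; exact: trigpoly_smooth.
Qed.

Definition cis (a : R) : C := Complex (cos a) (sin a).

Lemma cis0 : cis 0 = 1.
Proof. by rewrite /cis cos0 sin0. Qed.

Lemma cis_conj a : cis a * Num.conj (cis a) = 1.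
Proof.
apply/eqP; rewrite eq_complex /= mulrN opprK -!expr2 cos2Dsin2.
by rewrite mulrN mulrC addNr !eqxx.
Qed.

Variable n : nat.
Implicit Types (theta : 'I_n -> R).

(** The one-parameter group [exp(t D)] for the diagonal matrix [D] with entries [i theta_j]. *)
Definition cis_mx theta (t : R) : 'M[C]_n :=
  diag_mx (\row_j cis (theta j * t)).

Lemma cis_mx0 theta : cis_mx theta 0 = 1%:M.
Proof.
apply/matrixP => i j; rewrite !mxE mulr0 cis0; by case: eqP.
Qed.

Lemma cis_mx_unitary theta t : cis_mx theta t \is unitarymx.
Proof.
apply/unitarymxP; rewrite /cis_mx tr_diag_mx map_diag_mx mulmx_diag.
rewrite -diag_const_mx; congr diag_mx; apply/rowP => j.
by rewrite !mxE cis_conj.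
Qed.

Lemma trigmx_cis_mx theta : trigmx (cis_mx theta).
Proof.
move=> i j; split.
  case: (eqVneq i j) => [->|ij].
    have := trigpoly_cos (theta j).
    by congr trigpoly; apply/funext => t; rewrite !mxE eqxx.
  have := trigpoly_cst 0.
  by congr trigpoly; apply/funext => t; rewrite !mxE (negPf ij).
case: (eqVneq i j) => [->|ij].
  have := trigpoly_sin (theta j).
  by congr trigpoly; apply/funext => t; rewrite !mxE eqxx.
have := trigpoly_cst 0.
by congr trigpoly; apply/funext => t; rewrite !mxE (negPf ij).
Qed.

Lemma is_mxderive_cis_mx theta :
  is_mxderive 0 (cis_mx theta) (diag_mx (\row_j Complex 0 (theta j))).
Proof.
move=> i j; rewrite !mxE; case: (eqVneq i j) => [->|ij].
  rewrite mulr1n; split.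
    apply: is_derive_ext (is_derive_cosM (theta j) 0) => [t|].
      by rewrite !mxE eqxx.
    by rewrite mulr0 sin0 mulr0.
  apply: is_derive_ext (is_derive_sinM (theta j) 0) => [t|].
    by rewrite !mxE eqxx.
  by rewrite mulr0 cos0 mulr1.
rewrite mulr0n; have := is_cderive_cst 0 (0 : C).
by congr is_cderive; apply/funext => t; rewrite !mxE (negPf ij).
Qed.

(** Such a [K] is normal, hence unitarily diagonalizable, and each eigenvalue is minus its own
    conjugate. *)
Lemma skew_hermitian_spectral (K : 'M[C]_n) : K ^t* = - K ->
  exists P theta, P \is unitarymx /\
    K = P ^t* *m diag_mx (\row_j Complex 0 (theta j)) *m P.
Proof.
move=> Kskew.
have /orthomx_spectralP : K \is normalmx.
  by apply/normalmxP; rewrite Kskew mulmxN mulNmx.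
set P := spectralmx K; set d := spectral_diag K => KE.
have Pu : P \is unitarymx by exact: spectral_unitarymx.
rewrite invmx_unitary // in KE.
have dE : diag_mx d = P *m K *m P ^t*.
  by rewrite KE !mulmxA (unitarymxP Pu) mul1mx mulmxtVK.
have d_im j : Num.conj (d 0 j) = - d 0 j.
  have : (diag_mx d) ^t* = - diag_mx d.
    by rewrite dE !trmxC_mul trmxCK Kskew mulNmx mulmxN mulmxA.
  by move/matrixP/(_ j j); rewrite !mxE eqxx.
exists P, (fun j => complex.Im (d 0 j)); split=> //.
rewrite {1}KE; congr (_ *m diag_mx _ *m _); apply/rowP => j; rewrite mxE.
have := d_im j; case: (d 0 j) => a b /= [] /eqP; rewrite -subr_eq0 opprK.
by rewrite -mulr2n mulrn_eq0 /= => /eqP ->.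
Qed.

Lemma tangent_space_orbit_sup (A K : 'M[C]_n) : K ^t* = - K ->
  tangent_space (Defs.orbit A) A (K *m A - A *m K).
Proof.
move=> Kskew; have [P [theta [Pu KE]]] := skew_hermitian_spectral Kskew.
have PCP : P ^t* *m P = 1%:M by rewrite -invmx_unitary // mulVmx ?unitarymx_unit.
(* This is [exp(t K)], computed in an eigenbasis of [K]. *)
pose U t := P ^t* *m cis_mx theta t *m P.
have Uu t : U t \is unitarymx.
  by rewrite !mul_unitarymx ?cis_mx_unitary ?trmxC_unitary.
have UT : trigmx U.
  apply: trigmxM (trigmx_cst P).
  exact: trigmxM (trigmx_cst (P ^t*)) (trigmx_cis_mx theta).
have UD : is_mxderive 0 U K.
  have := is_mxderiveM (is_mxderiveM (is_mxderive_cst 0 (P ^t*))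
    (is_mxderive_cis_mx theta)) (is_mxderive_cst 0 P).
  by rewrite mul0mx mulmx0 add0r addr0 -KE.
have U0 : U 0 = 1%:M by rewrite /U cis_mx0 mulmx1.
exists (fun t => U t *m A *m (U t) ^t*); split.
- apply: trigmx_smooth_curve; apply: trigmxM (trigmxC UT).
  exact: trigmxM UT (trigmx_cst A).
- by move=> t; exists (U t) => //; rewrite invmx_unitary.
- by rewrite U0 trmx1 map_mx1 mul1mx mulmx1.
- apply: velocityE.
  have := is_mxderiveM (is_mxderiveM UD (is_mxderive_cst 0 A)) (is_mxderiveC UD).
  by rewrite U0 Kskew trmx1 map_mx1 !mulmx1 mulmx0 addr0 mul1mx mulmxN.
Qed.

End TrigonometricCurves.

(** * The transversality determinant *)

Section LaplaceExpansion.
Variable F : comNzRingType.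

Definition mx_of_rows m n (s : seq (seq F)) : 'M[F]_(m, n) :=
  \matrix_(i, j) (nth [::] s i)`_j.

(** Laplace expansion along the first row, on lists: a concrete determinant unfolds by computation
    to an expression fit for [ring]. *)
Fixpoint det_rows n (s : seq (seq F)) : F :=
  if n is m.+1 then
    foldr (fun j acc => (head [::] s)`_j *
      ((-1) ^+ j *
       det_rows m [seq take j r ++ drop j.+1 r | r <- behead s]) + acc)
      0 (iota 0 n)
  else 1.

Lemma det_mx_of_rows n s : \det (mx_of_rows n n s) = det_rows n s.
Proof.
elim: n s => [|n IHn] s; first by rewrite det_mx00.
rewrite (expand_det_row _ ord0) /=.
pose G j := (head [::] s)`_j *
  ((-1) ^+ j * det_rows n [seq take j r ++ drop j.+1 r | r <- behead s]).
transitivity (\sum_(j < n.+1) G j).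
  apply: eq_bigr => j _; rewrite mxE nth0 /cofactor add0n /G -IHn.
  congr (_ * (_ * \det _)); apply/matrixP => i k.
  rewrite !mxE lift0 -nth_behead.
  (* Rows missing from the list default to [[::]] and read as zero on both sides. *)
  have [is_|si] := ltnP i (size (behead s)); last first.
    by rewrite !nth_default ?size_map.
  rewrite (nth_map [::]) //; set r := nth [::] _ _.
  case: (ltnP j (size r)) => [jr|rj].
    rewrite nth_cat size_take jr nth_drop /= /bump.
    by case: ltnP => kj; [rewrite nth_take | rewrite add1n addSn subnKC].
  rewrite take_oversize // drop_oversize ?cats0 ?leqW //= /bump.
  case: leqP => // jk.
  by rewrite !nth_default // (leq_trans rj) // ?add1n ?leqW.
by rewrite -(big_mkord xpredT) unlock.
Qed.

(** The primed variables stand for complex conjugates. Taking them independent turns the formula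
    into a polynomial identity. *)
Lemma det_rows_transversality (x y z u v x' y' z' u' v' : F) :
  let w := - u - v in
  let w' := - u' - v' in
  det_rows 6
    [:: [:: x; - z; 0; 0; 0; u - w];
        [:: 0; y; - x; v - u; 0; 0];
        [:: - y; 0; z; 0; w - v; 0];
        [:: 0; 0; u' - w'; x'; - z'; 0];
        [:: v' - u'; 0; 0; 0; y'; - x'];
        [:: 0; w' - v'; 0; - y'; 0; z']] =
  - (((v - w) * x ^+ 2) * ((v' - w') * x' ^+ 2)
    + ((w - u) * y ^+ 2) * ((w' - u') * y' ^+ 2)
    + ((u - v) * z ^+ 2) * ((u' - v') * z' ^+ 2)
    + (((v - w) * x) * ((v' - w') * x') + (y * z) * (y' * z'))
      * (v * v' + w * w' - 5 * (u * u'))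
    + (((w - u) * y) * ((w' - u') * y') + (z * x) * (z' * x'))
      * (w * w' + u * u' - 5 * (v * v'))
    + (((u - v) * z) * ((u' - v') * z') + (x * y) * (x' * y'))
      * (u * u' + v * v' - 5 * (w * w'))
    + ((u - v) * (v - w) * (w - u)) * ((u' - v') * (v' - w') * (w' - u'))).
Proof.
move=> w w' /=; rewrite /w /w'; ring.
Qed.

End LaplaceExpansion.

(** * The linear system at the positions of [I1] *)

Section TransversalityI1.
Variable R : realType.
Local Notation C := R[i].

Lemma ord3P (P : 'I_3 -> Prop) :
  P (inord 0) -> P (inord 1) -> P (inord 2) -> forall i, P i.
Proof.
move=> P0 P1 P2 i; rewrite -(inord_val i).
by case: i => [[|[|[|?]]] ?].
Qed.

Lemma sum_ord3 (F : 'I_3 -> C) :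
  \sum_i F i = F (inord 0) + F (inord 1) + F (inord 2).
Proof.
rewrite !big_ord_recr big_ord0 /= add0r.
by congr (F _ + F _ + F _); apply: val_inj; rewrite /= inordK.
Qed.

Lemma sqr_normcE (z : C) :
  ((ComplexField.Normc.normc z)%:C ^+ 2)%C = z * Num.conj z.
Proof. by rewrite -normCK. Qed.

Variables x y z u v : C.
Local Notation w := (- u - v).
Local Notation A := (mxI1 x y z u v).

Lemma trace_mxI1 : \tr A = 0.
Proof. by rewrite /mxtrace sum_ord3 !mxE !inordK //= addrACA; ring. Qed.

Lemma pattern_I1 (B : 'M[C]_3) : \tr B = 0 ->
  B (inord 0) (inord 2) = 0 -> B (inord 1) (inord 0) = 0 ->
  B (inord 2) (inord 1) = 0 -> pattern I1 B.
Proof.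
move=> trB B02 B10 B21; split=> // i j; rewrite !inE !xpair_eqE.
by move=> /orP[/orP[]|] /andP[/eqP -> /eqP ->].
Qed.

Lemma pattern_mxI1 : pattern I1 A.
Proof. by apply: pattern_I1; rewrite ?trace_mxI1 // mxE !inordK. Qed.

(* The entries of [K A - A K] at the positions of [I1], as a real-linear
   function of the entries [K_12, K_23, K_31] of a skew-Hermitian [K]. *)
Definition transM : 'M[C]_3 :=
  mx_of_rows 3 3 [:: [:: x; - z; 0]; [:: 0; y; - x]; [:: - y; 0; z]].
Definition transN : 'M[C]_3 :=
  mx_of_rows 3 3 [:: [:: 0; 0; u - w]; [:: v - u; 0; 0]; [:: 0; w - v; 0]].

(** The diagonal can be zero: at the positions of [I1], the commutator with [A] multiplies it only
    by entries of [A] that vanish. *)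
Definition skew_mx (a : 'cV[C]_3) : 'M[C]_3 :=
  let a i := a (inord i) 0 in
  mx_of_rows 3 3
    [:: [:: 0; a 0%N; - Num.conj (a 2%N)]; [:: - Num.conj (a 0%N); 0; a 1%N];
        [:: a 2%N; - Num.conj (a 1%N); 0]].

Lemma skew_mxC a : (skew_mx a) ^t* = - skew_mx a.
Proof.
apply/matrixP; do 2!elim/ord3P; rewrite !mxE !inordK //=;
  by rewrite ?(rmorph0, oppr0, opprK) // rmorphN /= conjCK.
Qed.

Definition cyclic_entries (K : 'M[C]_3) : 'cV[C]_3 :=
  \col_i [:: K (inord 0) (inord 1); K (inord 1) (inord 2);
             K (inord 2) (inord 0)]`_i.

Definition I1_entries (B : 'M[C]_3) : 'cV[C]_3 :=
  \col_i [:: B (inord 0) (inord 2); B (inord 1) (inord 0);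
             B (inord 2) (inord 1)]`_i.

Lemma I1_entriesB B1 B2 : I1_entries (B1 - B2) = I1_entries B1 - I1_entries B2.
Proof. by apply/matrixP; elim/ord3P => j; rewrite !mxE !inordK //= !mxE. Qed.

Lemma skew_mxK a : cyclic_entries (skew_mx a) = a.
Proof.
by apply/matrixP; elim/ord3P => j; rewrite (ord1 j) !mxE !inordK.
Qed.

(** The off-diagonal entries of [K] outside the cyclic ones are minus conjugates of these, and they
    produce the antilinear part [transN]. *)
Lemma I1_entries_commutator K : K ^t* = - K ->
  I1_entries (K *m A - A *m K) =
  transM *m cyclic_entries K + transN *m map_mx Num.conj (cyclic_entries K).
Proof.
move=> Kskew.
have Kc i j : K i j = - Num.conj (K j i).
  by have /matrixP/(_ i j) := Kskew; rewrite !mxE => ->; rewrite opprK.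
apply/matrixP; elim/ord3P => j;
  rewrite !mxE !inordK //= !sum_ord3 !mxE !inordK //=.
- rewrite (Kc (inord 0) (inord 2)); ring.
- rewrite (Kc (inord 1) (inord 0)); ring.
- rewrite (Kc (inord 2) (inord 1)); ring.
Qed.

(** Modulo [pattern I1] a traceless matrix is determined by its three entries at [I1], so the
    commutators have to reach every such triple. *)
Lemma transversal_mxI1P :
  set_sum (pattern I1) (tangent_space (Defs.orbit A) A) = @traceless R 3 <->
  forall t : 'cV[C]_3, exists a : 'cV[C]_3,
    transM *m a + transN *m map_mx Num.conj a = t.
Proof.
split=> [sumE t | surj].
  pose B : 'M[C]_3 := mx_of_rows 3 3
    [:: [:: 0; 0; t (inord 0) 0]; [:: t (inord 1) 0; 0; 0];
        [:: 0; t (inord 2) 0; 0]].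
  have trB : traceless B.
    by rewrite /traceless /= /mxtrace sum_ord3 !mxE !inordK //= !addr0.
  have Bt : I1_entries B = t.
    apply/matrixP; elim/ord3P => j; by rewrite (ord1 j) !mxE !inordK.
  move: trB; rewrite -sumE => -[X [_ XI] [Y /tangent_space_orbit_sub]].
  move=> [K Kskew YE] XYB; exists (cyclic_entries K).
  rewrite -I1_entries_commutator // -YE -Bt -XYB.
  apply/matrixP; elim/ord3P => j; rewrite !mxE !inordK //= XI ?add0r //;
  by rewrite !inE !eqxx ?orbT.
apply/seteqP; split=> B /=.
  move=> [X [trX _] [Y /tangent_space_orbit_sub [K _ ->] <-]].
  by rewrite /traceless /= mxtraceD trX mxtraceB mxtrace_mulC subrr addr0.
move=> trB; have [a at_] := surj (I1_entries B).
(* By the choice of [a], [T] agrees with [B] at [I1], so [B - T] falls into the pattern. *)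
pose T := skew_mx a *m A - A *m skew_mx a.
have trT : \tr T = 0 by rewrite mxtraceB mxtrace_mulC subrr.
have TB : I1_entries T = I1_entries B.
  by rewrite I1_entries_commutator ?skew_mxC // skew_mxK.
exists (B - T); last first.
  exists T; last by rewrite subrK.
  exact/tangent_space_orbit_sup/skew_mxC.
have entB : I1_entries (B - T) = 0 by rewrite I1_entriesB TB subrr.
have entBk k : (I1_entries (B - T)) (inord k) 0 = 0 by rewrite entB mxE.
apply: pattern_I1; first by rewrite mxtraceB trB trT subrr.
- by have := entBk 0%N; rewrite mxE inordK.
- by have := entBk 1%N; rewrite mxE inordK.
- by have := entBk 2%N; rewrite mxE inordK.
Qed.

Lemma det_transversality :
  \det (block_mx transM transN (map_mx Num.conj transN) (map_mx Num.conj transM))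
  = - ((P1 A)%:C)%C.
Proof.
(* The blocks are flattened to six explicit rows with conjugation pushed onto the variables, to
   match [det_rows_transversality]. *)
have -> : block_mx transM transN (map_mx Num.conj transN)
    (map_mx Num.conj transM)
  = mx_of_rows (3 + 3) (3 + 3)
    (let c := Num.conj in
    [:: [:: x; - z; 0; 0; 0; u - w];
        [:: 0; y; - x; v - u; 0; 0];
        [:: - y; 0; z; 0; w - v; 0];
        [:: 0; 0; c u - (- c u - c v); c x; - c z; 0];
        [:: c v - c u; 0; 0; 0; c y; - c x];
        [:: 0; - c u - c v - c v; 0; - c y; 0; c z]]).
  apply/matrixP => i j.
  case: (split_ordP i) => i' ->; case: (split_ordP j) => j' ->;
    rewrite ?(block_mxEul, block_mxEur, block_mxEdl, block_mxEdr) !mxE /=;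
    move: i' j'; do 2!elim/ord3P; rewrite !inordK //=;
    by rewrite ?(rmorphB, rmorphN, rmorph0).
rewrite det_mx_of_rows [LHS]det_rows_transversality; congr (- _).
rewrite /P1 !mxE !inordK //=.
rewrite !(rmorphXn, rmorphN, rmorphD, rmorphM, rmorph_nat) /=.
rewrite !sqr_normcE; ring.
Qed.

End TransversalityI1.

Theorem proposition9p1 (R : realType) (x y z u v : R[i]) :
  nontransversal_at (mxI1 x y z u v) I1 (mxI1 x y z u v) <->
  Gamma1 (mxI1 x y z u v).
Proof.
set A := mxI1 x y z u v.
have P1A : P1 A = 0 <->
    set_sum (pattern I1) (tangent_space (Defs.orbit A) A) <> @traceless R 3.
  rewrite transversal_mxI1P real_linear_surjP det_transversality oppr_eq0.
  by rewrite fmorph_eq0; split=> [-> /eqP // | /negP]; rewrite negbK => /eqP.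
split=> [[_ /P1A] | [_ /P1A]]; first by split=> //; exact: pattern_mxI1.
split=> //; split; last exact: pattern_mxI1.
exists 1%:M; first by apply/unitarymxP; rewrite trmx1 map_mx1 mulmx1.
by rewrite mul1mx invmx1 mulmx1.
Qed.
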